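(* Let $\Bbbk$ be a field of characteristic zero. For a pre-Lie algebra $L$ over $\Bbbk$, let $\Omega^1_{\mathrm{PreLie}}(L)$ denote its module of Kähler differentials. Then there is a vector space isomorphism $$\Omega^1_{\mathrm{PreLie}}(L)\cong \overline{T}(L),$$ where $\overline{T}(L)=\bigoplus_{n\ge 1}L^{\otimes n}$ is the augmentation ideal of the tensor algebra of the vector space $L$. Moreover, these isomorphisms can be chosen in a way that is natural with respect to pre-Lie algebra morphisms, i.e. the functors $L\mapsto \Omega^1_{\mathrm{PreLie}}(L)$ and $L\mapsto\overline{T}(L)$ from pre-Lie algebras to vector spaces are naturally isomorphic.
   Context: A pre-Lie (right-symmetric) algebra is a vector space $L$ with a bilinear operation $\triangleleft$ satisfying $(a_1\triangleleft a_2)\triangleleft a_3 - a_1\triangleleft (a_2\triangleleft a_3)=(a_1\triangleleft a_3)\triangleleft a_2 - a_1\triangleleft (a_3\triangleleft a_2)$. An $L$-module is a vector space $E$ with bilinear maps $(a,e)\mapsto a\triangleleft e\in E$ and $(e,a)\mapsto e\triangleleft a\in E$ for $a\in L$, $e\in E$, such that $L\oplus E$, with the product extending that of $L$ by these maps and by $E\triangleleft E=0$, is a pre-Lie algebra. A derivation of $L$ with values in $E$ is a linear map $D\colon L\to E$ with $D(a\triangleleft b)=D(a)\triangleleft b+a\triangleleft D(b)$. The module of Kähler differentials $\Omega^1_{\mathrm{PreLie}}(L)$ is the $L$-module representing the functor $E\mapsto \mathrm{Der}(L,E)$: there is a universal derivation $d\colon L\to\Omega^1_{\mathrm{PreLie}}(L)$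 through which every derivation $L\to E$ factors via a unique $L$-module morphism. Equivalently, it is the $L$-module generated by symbols $da$, linear in $a\in L$, modulo the relations $d(a\triangleleft b)=da\triangleleft b+a\triangleleft db$. A morphism $f\colon L\to L'$ of pre-Lie algebras induces the linear map $\Omega^1_{\mathrm{PreLie}}(L)\to\Omega^1_{\mathrm{PreLie}}(L')$ that sends $da$ to $d f(a)$ and is compatible with the module structures via $f$. *)

(* Defs.v *)
From HB Require Import structures.
From mathcomp Require Import all_boot all_order all_algebra.
From mathcomp Require Import generic_quotient boolp.

Set Implicit Arguments.
Unset Strict Implicit.
Unset Printing Implicit Defensive.

Import GRing.Theory.
Local Open Scope ring_scope.
Local Open Scope quotient_scope.

Definition right_symmetric (V : zmodType) (op : V -> V -> V) : Prop :=
  forall a1 a2 a3,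
    op (op a1 a2) a3 - op a1 (op a2 a3) = op (op a1 a3) a2 - op a1 (op a3 a2).

HB.mixin Record Lmodule_isPreLie (K : fieldType) L of GRing.Lmodule K L := {
  pl_mul : L -> L -> L;
  pl_mul_linearl : forall b, linear (pl_mul^~ b);
  pl_mul_linearr : forall a, linear (pl_mul a);
  pl_mul_rsym : right_symmetric pl_mul
}.

#[short(type="preLieType")]
HB.structure Definition PreLie (K : fieldType) :=
  {L of GRing.Lmodule K L & Lmodule_isPreLie K L}.

Notation "a ◁ b" := (pl_mul a b) (at level 40, left associativity).

Record preLieHom (K : fieldType) (L L' : preLieType K) := PreLieHom {
  hom_fun :> {linear L -> L'};
  hom_mul : forall a b, hom_fun (a ◁ b) = hom_fun a ◁ hom_fun b
}.

Definition idHom (K : fieldType) (L : preLieType K) : preLieHom L L :=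
  @PreLieHom K L L idfun (fun _ _ => erefl).

Definition compHom (K : fieldType) (L1 L2 L3 : preLieType K)
    (g : preLieHom L2 L3) (f : preLieHom L1 L2) : preLieHom L1 L3.
Proof. by exists (g \o f : {linear L1 -> L3}) => a b /=; rewrite !hom_mul. Defined.

Definition semidirect_mul (K : fieldType) (L : preLieType K) (E : lmodType K)
    (lact : L -> E -> E) (ract : E -> L -> E) (x y : L * E) : L * E :=
  (x.1 ◁ y.1, lact x.1 y.2 + ract x.2 y.1).

Record preLieMod (K : fieldType) (L : preLieType K) := PreLieMod {
  mod_space :> lmodType K;
  lact : L -> mod_space -> mod_space;
  ract : mod_space -> L -> mod_space;
  lact_linearl : forall e, linear (lact^~ e);
  lact_linearr : forall a, linear (lact a);
  ract_linearl : forall a, linear (ract^~ a);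
  ract_linearr : forall e, linear (ract e);
  mod_rsym : right_symmetric (semidirect_mul lact ract)
}.

Lemma linD (K : fieldType) (U V : lmodType K) (f : U -> V) x y :
  linear f -> f (x + y) = f x + f y.
Proof. by move=> fl; rewrite -{1}(scale1r x) fl scale1r. Qed.

Lemma lin0 (K : fieldType) (U V : lmodType K) (f : U -> V) :
  linear f -> f 0 = 0.
Proof. by move=> fl; apply: (addrI (f 0)); rewrite -linD // !addr0. Qed.

Section ModuleIdentities.
Variables (K : fieldType) (L : preLieType K) (E : preLieMod L).

Lemma lact0l (e : E) : lact 0 e = 0.
Proof. exact: (lin0 (lact_linearl e)). Qed.
Lemma lact0r a : lact a (0 : E) = 0.
Proof. exact: (lin0 (lact_linearr a)). Qed.
Lemma ract0l a : ract (0 : E) a = 0.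
Proof. exact: (lin0 (ract_linearl a)). Qed.
Lemma ract0r (e : E) : ract e 0 = 0.
Proof. exact: (lin0 (ract_linearr e)). Qed.
Lemma pl_mul0l (a : L) : 0 ◁ a = 0.
Proof. exact: (lin0 (pl_mul_linearl a)). Qed.
Lemma pl_mul0r (a : L) : a ◁ 0 = 0.
Proof. exact: (lin0 (pl_mul_linearr a)). Qed.
Definition act0 := (lact0l, lact0r, ract0l, ract0r, pl_mul0l, pl_mul0r).

Lemma ract_rsym (e : E) a b :
  ract (ract e a) b - ract e (a ◁ b) = ract (ract e b) a - ract e (b ◁ a).
Proof.
have /(congr1 snd) /= := mod_rsym (0, e) (a, 0) (b, 0).
by rewrite !act0 ?(add0r, addr0) ?act0 ?(add0r, addr0).
Qed.

Lemma lact_rsym a (e : E) b :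
  ract (lact a e) b - lact a (ract e b) = lact (a ◁ b) e - lact a (lact b e).
Proof.
have /(congr1 snd) /= := mod_rsym (a, 0) (0, e) (b, 0).
by rewrite !act0 ?(add0r, addr0) ?act0 ?(add0r, addr0).
Qed.

End ModuleIdentities.

Definition is_derivation (K : fieldType) (L : preLieType K) (E : preLieMod L)
    (D : {linear L -> E}) : Prop :=
  forall a b, D (a ◁ b) = ract (D a) b + lact a (D b).

Definition is_mod_morphism (K : fieldType) (L : preLieType K)
    (E E' : preLieMod L) (g : {linear E -> E'}) : Prop :=
  (forall a e, g (lact a e) = lact a (g e)) /\
  (forall e a, g (ract e a) = ract (g e) a).

(* [presented R] is the K-vector space with I-indexed linear endomorphisms    *)
(* that is generated by G subject to the relations R.                         *)
Section Presented.
Variables (K : fieldType) (G I : Type).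

Inductive term : Type :=
| Gen of G
| Op of I & term
| Zero
| Add of term & term
| Opp of term
| Scale of K & term.

Inductive cong (R : term -> term -> Prop) : term -> term -> Prop :=
| cong_rel x y : R x y -> cong R x y
| cong_refl x : cong R x x
| cong_sym x y : cong R x y -> cong R y x
| cong_trans y x z : cong R x y -> cong R y z -> cong R x z
| cong_op i x y : cong R x y -> cong R (Op i x) (Op i y)
| cong_add x x' y y' :
    cong R x x' -> cong R y y' -> cong R (Add x y) (Add x' y')
| cong_opp x y : cong R x y -> cong R (Opp x) (Opp y)
| cong_scale k x y : cong R x y -> cong R (Scale k x) (Scale k y)
| cong_addA x y z : cong R (Add x (Add y z)) (Add (Add x y) z)
| cong_addC x y : cong R (Add x y) (Add y x)
| cong_add0 x : cong R (Add Zero x) x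
| cong_addN x : cong R (Add (Opp x) x) Zero
| cong_scaleA k l x : cong R (Scale k (Scale l x)) (Scale (k * l) x)
| cong_scale1 x : cong R (Scale 1 x) x
| cong_scaleDr k x y :
    cong R (Scale k (Add x y)) (Add (Scale k x) (Scale k y))
| cong_scaleDl k l x :
    cong R (Scale (k + l) x) (Add (Scale k x) (Scale l x))
| cong_op_linear i k x y :
    cong R (Op i (Add (Scale k x) y)) (Add (Scale k (Op i x)) (Op i y)).

Variable R : term -> term -> Prop.

Definition congb (x y : {classic term}) : bool := `[< cong R x y >].

Lemma congb_equiv : equiv_class_of congb.
Proof.
split.
- by move=> x; apply/asboolP; exact: cong_refl.
- by move=> x y; apply/asboolP/asboolP; exact: cong_sym.
- by move=> y x z /asboolP xy /asboolP yz; apply/asboolP; exact: cong_trans xy yz.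
Qed.

Canonical congb_equiv_rel := EquivRelPack congb_equiv.

Definition presented : Type := {eq_quot congb_equiv_rel}.

HB.instance Definition _ := Choice.on presented.

Definition cls (t : term) : presented := \pi_({eq_quot congb_equiv_rel}) t.
Definition rep (x : presented) : term := repr (x : {eq_quot congb_equiv_rel}).

Lemma repK x : cls (rep x) = x. Proof. exact: reprK. Qed.

Lemma clsP s t : cls s = cls t <-> cong R s t.
Proof. by split => [/eqmodP/asboolP|st]//; apply/eqmodP/asboolP. Qed.

Lemma cong_rep t : cong R (rep (cls t)) t.
Proof. by apply/clsP; rewrite repK. Qed.

Definition pzero := cls Zero.
Definition padd x y := cls (Add (rep x) (rep y)).
Definition popp x := cls (Opp (rep x)).
Definition pscale k x := cls (Scale k (rep x)).

Lemma paddE s t : padd (cls s) (cls t) = cls (Add s t).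
Proof. by apply/clsP; apply: cong_add; exact: cong_rep. Qed.
Lemma poppE s : popp (cls s) = cls (Opp s).
Proof. by apply/clsP; apply: cong_opp; exact: cong_rep. Qed.
Lemma pscaleE k s : pscale k (cls s) = cls (Scale k s).
Proof. by apply/clsP; apply: cong_scale; exact: cong_rep. Qed.

Lemma paddA : associative padd.
Proof.
move=> x y z; rewrite -(repK x) -(repK y) -(repK z) !paddE.
by apply/clsP; exact: cong_addA.
Qed.
Lemma paddC : commutative padd.
Proof.
move=> x y; rewrite -(repK x) -(repK y) !paddE.
by apply/clsP; exact: cong_addC.
Qed.
Lemma padd0 : left_id pzero padd.
Proof. by move=> x; rewrite -(repK x) paddE; apply/clsP; exact: cong_add0. Qed.
Lemma paddN : left_inverse pzero popp padd.
Proof.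
by move=> x; rewrite -(repK x) poppE paddE; apply/clsP; exact: cong_addN.
Qed.

HB.instance Definition _ :=
  GRing.isZmodule.Build presented paddA paddC padd0 paddN.

Lemma clsD s t : cls (Add s t) = cls s + cls t.
Proof. by rewrite -paddE. Qed.

Lemma pscaleA k l x : pscale k (pscale l x) = pscale (k * l) x.
Proof.
by rewrite -(repK x) !pscaleE; apply/clsP; exact: cong_scaleA.
Qed.
Lemma pscale1 : left_id 1 pscale.
Proof. by move=> x; rewrite -(repK x) pscaleE; apply/clsP; exact: cong_scale1. Qed.
Lemma pscaleDr : right_distributive pscale +%R.
Proof.
move=> k x y; rewrite -(repK x) -(repK y) -clsD !pscaleE -clsD.
by apply/clsP; exact: cong_scaleDr.
Qed.
Lemma pscaleDl x : {morph pscale^~ x : k l / k + l}.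
Proof.
move=> k l; rewrite -(repK x) !pscaleE -clsD.
by apply/clsP; exact: cong_scaleDl.
Qed.

HB.instance Definition _ := GRing.Zmodule_isLmodule.Build K presented
  pscaleA pscale1 pscaleDr pscaleDl.

Definition pgen (g : G) : presented := cls (Gen g).
Definition pop (i : I) (x : presented) : presented := cls (Op i (rep x)).

Lemma cls0 : cls Zero = 0. Proof. by []. Qed.
Lemma clsN s : cls (Opp s) = - cls s.
Proof. by rewrite -poppE. Qed.
Lemma clsZ k s : cls (Scale k s) = k *: cls s.
Proof. by rewrite -pscaleE. Qed.
Lemma clsOp i s : cls (Op i s) = pop i (cls s).
Proof. by apply/clsP/cong_op/cong_sym; exact: cong_rep. Qed.
Definition clsE := (cls0, clsD, clsN, clsZ, clsOp).

Lemma cls_rel s t : R s t -> cls s = cls t.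
Proof. by move=> st; apply/clsP/cong_rel. Qed.

Lemma pop_linear i : linear (pop i).
Proof.
move=> k x y; rewrite -(repK x) -(repK y) -clsZ -clsD -!clsOp -clsZ -clsD.
by apply/clsP; exact: cong_op_linear.
Qed.

Lemma presented_ind (P : presented -> Prop) :
  (forall g, P (pgen g)) -> (forall i x, P x -> P (pop i x)) -> P 0 ->
  (forall x y, P x -> P y -> P (x + y)) -> (forall x, P x -> P (- x)) ->
  (forall k x, P x -> P (k *: x)) -> forall x, P x.
Proof.
move=> Pg Po P0 PD PN PZ x; rewrite -(repK x).
by elim: (rep x) => [g|i t IH||s IHs t IHt|t IH|k t IH];
  rewrite ?clsE; [exact: Pg|exact: Po|exact: P0|exact: PD|exact: PN|exact: PZ].
Qed.

Section Lift.
Variables (W : lmodType K) (g : G -> W) (o : I -> W -> W).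

Fixpoint eval (t : term) : W :=
  match t with
  | Gen x => g x
  | Op i t => o i (eval t)
  | Zero => 0
  | Add s t => eval s + eval t
  | Opp t => - eval t
  | Scale k t => k *: eval t
  end.

Definition plift (x : presented) : W := eval (rep x).

Hypothesis o_linear : forall i, linear (o i).
Hypothesis evalR : forall s t, R s t -> eval s = eval t.

Lemma eval_cong s t : cong R s t -> eval s = eval t.
Proof.
elim=> //=.
- by move=> x y z _ -> _ ->.
- by move=> i x y _ ->.
- by move=> x x' y y' _ -> _ ->.
- by move=> x y _ ->.
- by move=> k x y _ ->.
- by move=> x y z; rewrite addrA.
- by move=> x y; rewrite addrC.
- by move=> x; rewrite add0r.
- by move=> x; rewrite addNr.
- by move=> k l x; rewrite scalerA.
- by move=> x; rewrite scale1r.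
- by move=> k x y; rewrite scalerDr.
- by move=> k l x; rewrite scalerDl.
- by move=> i k x y; rewrite o_linear.
Qed.

Lemma plift_cls t : plift (cls t) = eval t.
Proof. by apply: eval_cong; exact: cong_rep. Qed.

Lemma plift_gen x : plift (pgen x) = g x.
Proof. exact: plift_cls. Qed.

Lemma plift_op i x : plift (pop i x) = o i (plift x).
Proof. by rewrite -(repK x) -clsOp !plift_cls. Qed.

Lemma plift_linear : linear plift.
Proof.
by move=> k x y; rewrite -(repK x) -(repK y) -clsZ -clsD !plift_cls.
Qed.

End Lift.
End Presented.

Arguments Zero {K G I}.
Arguments Gen {K G I} _.
Arguments Op {K G I} _ _.

Definition packLinear (K : fieldType) (U V : lmodType K) (h : U -> V)
    (hl : linear h) : {linear U -> V} :=
  HB.pack h (GRing.isLinear.Build K U V *:%R h hl).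

Section Tensor.
Variables (K : fieldType) (U V : lmodType K).

Inductive tensor_rel : term K (U * V) void -> term K (U * V) void -> Prop :=
| tensor_linearl k u u' v : tensor_rel
    (Gen (k *: u + u', v)) (Add (Scale k (Gen (u, v))) (Gen (u', v)))
| tensor_linearr k u v v' : tensor_rel
    (Gen (u, k *: v + v')) (Add (Scale k (Gen (u, v))) (Gen (u, v'))).

Definition tensor : lmodType K := presented tensor_rel.

Definition tmul (u : U) (v : V) : tensor := pgen tensor_rel (u, v).

Lemma tmul_linearl v : linear (tmul^~ v).
Proof.
by move=> k u u'; rewrite /tmul /pgen (cls_rel (tensor_linearl k u u' v)) !clsE.
Qed.

Lemma tmul_linearr u : linear (tmul u).
Proof.
by move=> k v v'; rewrite /tmul /pgen (cls_rel (tensor_linearr k u v v')) !clsE.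
Qed.

Definition tensor_lift (W : lmodType K) (h : U -> V -> W) (x : tensor) : W :=
  plift (fun p => h p.1 p.2) (fun i : void => match i with end) x.

Section TensorLift.
Variables (W : lmodType K) (h : U -> V -> W).
Hypotheses (hl : forall v, linear (h^~ v)) (hr : forall u, linear (h u)).

Lemma tensor_evalR s t : tensor_rel s t ->
  eval (fun p => h p.1 p.2) (fun i : void => match i with end) s =
  eval (fun p => h p.1 p.2) (fun i : void => match i with end) t.
Proof. by case=> *; [exact: hl|exact: hr]. Qed.

Lemma tensor_lift_linear : linear (tensor_lift h).
Proof. by apply: plift_linear; [case|exact: tensor_evalR]. Qed.

Lemma tensor_liftE u v : tensor_lift h (tmul u v) = h u v.
Proof. by apply: plift_gen; [case|exact: tensor_evalR]. Qed.

Lemma tensor_universal : exists g : {linear tensor -> W},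
  (forall u v, g (tmul u v) = h u v) /\
  (forall g' : {linear tensor -> W},
     (forall u v, g' (tmul u v) = h u v) -> g' =1 g).
Proof.
exists (packLinear tensor_lift_linear); split; first exact: tensor_liftE.
move=> g' g'E x; elim/(@presented_ind _ _ _ tensor_rel): x
  => [[u v]|[]||x y IHx IHy|x IH|k x IH].
- by rewrite g'E; apply/esym; exact: tensor_liftE.
- by rewrite !linear0.
- by rewrite !linearD IHx IHy.
- by rewrite !linearN IH.
- by rewrite !linearZ IH.
Qed.

End TensorLift.
End Tensor.

Definition tensor_map (K : fieldType) (U V U' V' : lmodType K)
    (f : {linear U -> U'}) (g : {linear V -> V'}) :
  {linear tensor U V -> tensor U' V'}.
Proof.
apply: (@packLinear _ _ _ (tensor_lift (fun u v => tmul (f u) (g v)))).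
by apply: tensor_lift_linear => [v|u] k x y; rewrite linearP;
  [exact: tmul_linearl|exact: tmul_linearr].
Defined.

Lemma tensor_mapE (K : fieldType) (U V U' V' : lmodType K)
    (f : {linear U -> U'}) (g : {linear V -> V'}) u v :
  tensor_map f g (tmul u v) = tmul (f u) (g v).
Proof.
apply: tensor_liftE => [v'|u'] k x y; rewrite linearP;
  [exact: tmul_linearl|exact: tmul_linearr].
Qed.

Lemma tensor_ext (K : fieldType) (U V W : lmodType K)
    (g g' : {linear tensor U V -> W}) :
  (forall u v, g (tmul u v) = g' (tmul u v)) -> g =1 g'.
Proof.
move=> gE x; elim/(@presented_ind _ _ _ (@tensor_rel K U V)): x
  => [[u v]|[]||x y IHx IHy|x IH|k x IH].
- exact: gE.
- by rewrite !linear0.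
- by rewrite !linearD IHx IHy.
- by rewrite !linearN IH.
- by rewrite !linearZ IH.
Qed.

Section DirectSum.
Variables (K : fieldType) (F : nat -> lmodType K).

Definition finite_support (f : forall n, F n) : Prop :=
  exists N, forall n, (N <= n)%N -> f n = 0.

Record dsum : Type := DSum {
  dsum_fun :> forall n, F n;
  dsum_finite : `[< finite_support dsum_fun >]
}.

HB.instance Definition _ := [isSub for dsum_fun].
HB.instance Definition _ := [Choice of dsum by <:].

Lemma dsumP (x y : dsum) : (forall n, x n = y n) -> x = y.
Proof. by move=> xy; apply: val_inj; apply: functional_extensionality_dep. Qed.

Lemma dsum0_subproof : `[< finite_support (fun _ => 0) >].
Proof. by apply/asboolP; exists 0%N. Qed.
Lemma dsumD_subproof (x y : dsum) : `[< finite_support (fun n => x n + y n) >].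
Proof.
case/asboolP: (dsum_finite x) => M xM; case/asboolP: (dsum_finite y) => N yN.
apply/asboolP; exists (maxn M N) => n; rewrite geq_max => /andP[Mn Nn].
by rewrite xM // yN // addr0.
Qed.
Lemma dsumN_subproof (x : dsum) : `[< finite_support (fun n => - x n) >].
Proof.
case/asboolP: (dsum_finite x) => N xN.
by apply/asboolP; exists N => n /xN ->; rewrite oppr0.
Qed.
Lemma dsumZ_subproof k (x : dsum) : `[< finite_support (fun n => k *: x n) >].
Proof.
case/asboolP: (dsum_finite x) => N xN.
by apply/asboolP; exists N => n /xN ->; rewrite scaler0.
Qed.

Definition dsum_zero := DSum dsum0_subproof.
Definition dsum_add x y := DSum (dsumD_subproof x y).
Definition dsum_opp x := DSum (dsumN_subproof x).
Definition dsum_scale k x := DSum (dsumZ_subproof k x).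

Lemma dsum_addA : associative dsum_add.
Proof. by move=> x y z; apply: dsumP => n /=; rewrite addrA. Qed.
Lemma dsum_addC : commutative dsum_add.
Proof. by move=> x y; apply: dsumP => n /=; rewrite addrC. Qed.
Lemma dsum_add0 : left_id dsum_zero dsum_add.
Proof. by move=> x; apply: dsumP => n /=; rewrite add0r. Qed.
Lemma dsum_addN : left_inverse dsum_zero dsum_opp dsum_add.
Proof. by move=> x; apply: dsumP => n /=; rewrite addNr. Qed.

HB.instance Definition _ :=
  GRing.isZmodule.Build dsum dsum_addA dsum_addC dsum_add0 dsum_addN.

Lemma dsum_scaleA k l x : dsum_scale k (dsum_scale l x) = dsum_scale (k * l) x.
Proof. by apply: dsumP => n /=; rewrite scalerA. Qed.
Lemma dsum_scale1 : left_id 1 dsum_scale.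
Proof. by move=> x; apply: dsumP => n /=; rewrite scale1r. Qed.
Lemma dsum_scaleDr : right_distributive dsum_scale +%R.
Proof. by move=> k x y; apply: dsumP => n /=; rewrite scalerDr. Qed.
Lemma dsum_scaleDl x : {morph dsum_scale^~ x : k l / k + l}.
Proof. by move=> k l; apply: dsumP => n /=; rewrite scalerDl. Qed.

HB.instance Definition _ := GRing.Zmodule_isLmodule.Build K dsum
  dsum_scaleA dsum_scale1 dsum_scaleDr dsum_scaleDl.

End DirectSum.

Section DirectSumMap.
Variables (K : fieldType) (F F' : nat -> lmodType K).
Variable f : forall n, {linear F n -> F' n}.

Lemma dsum_map_subproof (x : dsum F) :
  `[< finite_support (fun n => f n (x n)) >].
Proof.
case/asboolP: (dsum_finite x) => N xN.
by apply/asboolP; exists N => n /xN ->; rewrite linear0.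
Qed.

Definition dsum_map_fun (x : dsum F) : dsum F' := DSum (dsum_map_subproof x).

Lemma dsum_map_linear : linear dsum_map_fun.
Proof. by move=> k x y; apply: dsumP => n; exact: linearP. Qed.

Definition dsum_map : {linear dsum F -> dsum F'} := packLinear dsum_map_linear.

End DirectSumMap.

(* [tpow V n] is the tensor power of exponent n + 1, so that [Tbar V] is the   *)
(* direct sum of the tensor powers of positive exponent.                      *)
Fixpoint tpow (K : fieldType) (V : lmodType K) (n : nat) : lmodType K :=
  if n is m.+1 then tensor V (tpow V m) else V.

Fixpoint tpow_map (K : fieldType) (V V' : lmodType K) (f : {linear V -> V'})
    (n : nat) : {linear tpow V n -> tpow V' n} :=
  if n is m.+1 then tensor_map f (tpow_map f m) else f.

Definition Tbar (K : fieldType) (V : lmodType K) : lmodType K := dsum (tpow V).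

Definition Tbar_map (K : fieldType) (V V' : lmodType K) (f : {linear V -> V'}) :
  {linear Tbar V -> Tbar V'} := dsum_map (tpow_map f).

Lemma tpow_map_id (K : fieldType) (V : lmodType K) n :
  tpow_map (idfun : {linear V -> V}) n =1 id.
Proof.
elim: n => [//|n IH].
apply: (@tensor_ext _ _ _ _ (tpow_map idfun n.+1) idfun) => u v.
by rewrite [LHS]tensor_mapE IH.
Qed.

Lemma tpow_map_comp (K : fieldType) (V1 V2 V3 : lmodType K)
    (g : {linear V2 -> V3}) (f : {linear V1 -> V2}) n :
  tpow_map (g \o f : {linear V1 -> V3}) n =1 tpow_map g n \o tpow_map f n.
Proof.
elim: n => [//|n IH].
apply: (@tensor_ext _ _ _ _ (tpow_map (g \o f) n.+1)
          (tpow_map g n.+1 \o tpow_map f n.+1)) => u v.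
rewrite [LHS]tensor_mapE IH; apply/esym.
exact: etrans (congr1 (tpow_map g n.+1) (tensor_mapE _ _ _ _))
  (tensor_mapE _ _ _ _).
Qed.

Lemma Tbar_map_id (K : fieldType) (V : lmodType K) :
  Tbar_map (idfun : {linear V -> V}) =1 id.
Proof. by move=> x; apply: dsumP => n; exact: tpow_map_id. Qed.

Lemma Tbar_map_comp (K : fieldType) (V1 V2 V3 : lmodType K)
    (g : {linear V2 -> V3}) (f : {linear V1 -> V2}) :
  Tbar_map (g \o f : {linear V1 -> V3}) =1 Tbar_map g \o Tbar_map f.
Proof. by move=> x; apply: dsumP => n; exact: tpow_map_comp. Qed.

Section Kaehler.
Variables (K : fieldType) (L : preLieType K).

Variant side := Left | Right.

Definition omega_term : Type := term K L (side * L).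

Definition tl (a : L) (e : omega_term) : omega_term := Op (Left, a) e.
Definition tr (e : omega_term) (a : L) : omega_term := Op (Right, a) e.
Definition td (a : L) : omega_term := Gen a.
Definition tsub (e e' : omega_term) : omega_term := Add e (Opp e').

(* Linearity of [tl a] and [tr ^~ a] is part of [presented].  The relations   *)
(* [omega_mod1] and [omega_mod2] are right symmetry in the semidirect product *)
(* for one argument in the module, placed first or second.                    *)
Inductive omega_rel : omega_term -> omega_term -> Prop :=
| omega_d_linear k a b :
    omega_rel (td (k *: a + b)) (Add (Scale k (td a)) (td b))
| omega_l_linear k a b e :
    omega_rel (tl (k *: a + b) e) (Add (Scale k (tl a e)) (tl b e))
| omega_r_linear k a b e :
    omega_rel (tr e (k *: a + b)) (Add (Scale k (tr e a)) (tr e b))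
| omega_mod1 e a b :
    omega_rel (tsub (tr (tr e a) b) (tr e (a ◁ b)))
              (tsub (tr (tr e b) a) (tr e (b ◁ a)))
| omega_mod2 a e b :
    omega_rel (tsub (tr (tl a e) b) (tl a (tr e b)))
              (tsub (tl (a ◁ b) e) (tl a (tl b e)))
| omega_leibniz a b :
    omega_rel (td (a ◁ b)) (Add (tr (td a) b) (tl a (td b))).

Definition omega_space : lmodType K := presented omega_rel.
Definition omega_l (a : L) (e : omega_space) : omega_space := pop (Left, a) e.
Definition omega_r (e : omega_space) (a : L) : omega_space := pop (Right, a) e.

Lemma omega_lE a t : omega_l a (cls omega_rel t) = cls omega_rel (tl a t).
Proof. by rewrite clsOp. Qed.
Lemma omega_rE a t : omega_r (cls omega_rel t) a = cls omega_rel (tr t a).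
Proof. by rewrite clsOp. Qed.

Lemma omega_l_linearl e : linear (omega_l^~ e).
Proof.
move=> k a b; rewrite -(repK e) !omega_lE.
by rewrite (cls_rel (omega_l_linear k a b (rep e))) !clsE.
Qed.
Lemma omega_l_linearr a : linear (omega_l a).
Proof. exact: pop_linear. Qed.
Lemma omega_r_linearl a : linear (omega_r^~ a).
Proof. exact: pop_linear. Qed.
Lemma omega_r_linearr e : linear (omega_r e).
Proof.
move=> k a b; rewrite -(repK e) !omega_rE.
by rewrite (cls_rel (omega_r_linear k a b (rep e))) !clsE.
Qed.

Lemma omega_rsym1 e a b :
  omega_r (omega_r e a) b - omega_r e (a ◁ b) =
  omega_r (omega_r e b) a - omega_r e (b ◁ a).
Proof.
rewrite -(repK e) !omega_rE -!clsN -!clsD.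
exact: (cls_rel (omega_mod1 (rep e) a b)).
Qed.

Lemma omega_rsym2 a e b :
  omega_r (omega_l a e) b - omega_l a (omega_r e b) =
  omega_l (a ◁ b) e - omega_l a (omega_l b e).
Proof.
rewrite -(repK e) !(omega_rE, omega_lE) -!clsN -!clsD.
exact: (cls_rel (omega_mod2 a (rep e) b)).
Qed.

Lemma omega_rsym : right_symmetric (semidirect_mul omega_l omega_r).
Proof.
move=> [a1 e1] [a2 e2] [a3 e3]; rewrite /semidirect_mul /=.
congr pair; first exact: pl_mul_rsym.
rewrite !(linD _ _ (omega_r_linearl _)) !(linD _ _ (omega_l_linearr _)).
have E1 := omega_rsym1 e1 a2 a3.
have E2 := omega_rsym2 a1 e2 a3.
have E3 := omega_rsym2 a1 e3 a2.
have R3 (x y z x' y' z' : omega_space) :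
    x + (y + z) - (x' + y' + z') = (x - x') + ((y - y') + (z - z')).
  by rewrite -(addrA x') opprD addrACA; congr (_ + _); rewrite opprD addrACA.
by rewrite !R3 E1 E2 E3 addrCA.
Qed.

Definition Omega1 : preLieMod L :=
  PreLieMod omega_l_linearl omega_l_linearr omega_r_linearl omega_r_linearr
    omega_rsym.

Lemma kd_linear : linear (pgen omega_rel : L -> Omega1).
Proof.
move=> k a b; rewrite /pgen (cls_rel (omega_d_linear k a b)).
by rewrite (clsD omega_rel) (clsZ omega_rel).
Qed.

Definition kd : {linear L -> Omega1} := packLinear kd_linear.

Lemma kd_derivation : is_derivation kd.
Proof.
move=> a b; rewrite /= omega_rE omega_lE -[RHS]clsD.
exact: (cls_rel (omega_leibniz a b)).
Qed.

Lemma Omega1_ind (P : Omega1 -> Prop) :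
  (forall a, P (kd a)) -> (forall a e, P e -> P (lact a e)) ->
  (forall e a, P e -> P (ract e a)) -> P 0 ->
  (forall x y, P x -> P y -> P (x + y)) -> (forall k x, P x -> P (k *: x)) ->
  forall x, P x.
Proof.
move=> Pd Pl Pr P0 PD PZ x.
elim/(@presented_ind _ _ _ omega_rel): x => //.
- by case=> [[] a] e Pe; [exact: Pl|exact: Pr].
- by move=> e Pe; rewrite -scaleN1r; exact: PZ.
Qed.

End Kaehler.

Section KaehlerMap.
Variables (K : fieldType) (L L' : preLieType K).
Variables (f : preLieHom L L') (E : preLieMod L') (D : {linear L -> E}).
Hypothesis D_der : forall a b, D (a ◁ b) = ract (D a) (f b) + lact (f a) (D b).

Definition semi_op (i : side * L) (e : E) : E :=
  match i.1 with Left => lact (f i.2) e | Right => ract e (f i.2) end.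

Lemma semi_op_linear i : linear (semi_op i).
Proof.
by case: i => [[] a]; [exact: lact_linearr|exact: ract_linearl].
Qed.

Lemma semi_evalR s t : omega_rel s t -> eval D semi_op s = eval D semi_op t.
Proof.
case=> *; rewrite /= /semi_op /=.
- exact: linearP.
- by rewrite linearP lact_linearl.
- by rewrite linearP ract_linearr.
- by rewrite !hom_mul ract_rsym.
- by rewrite !hom_mul lact_rsym.
- exact: D_der.
Qed.

Definition semi_lift : {linear Omega1 L -> E} :=
  packLinear (plift_linear semi_op_linear semi_evalR).

Lemma semi_lift_d a : semi_lift (kd L a) = D a.
Proof. exact: (plift_gen semi_op_linear semi_evalR). Qed.
Lemma semi_lift_l a e : semi_lift (lact a e) = lact (f a) (semi_lift e).
Proof. exact: (plift_op semi_op_linear semi_evalR (Left, a)). Qed.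
Lemma semi_lift_r e a : semi_lift (ract e a) = ract (semi_lift e) (f a).
Proof. exact: (plift_op semi_op_linear semi_evalR (Right, a)). Qed.

Lemma semi_lift_unique (g : {linear Omega1 L -> E}) :
  (forall a, g (kd L a) = D a) ->
  (forall a e, g (lact a e) = lact (f a) (g e)) ->
  (forall e a, g (ract e a) = ract (g e) (f a)) ->
  g =1 semi_lift.
Proof.
move=> gd gl gr; elim/Omega1_ind => [a|a e IH|e a IH||x y IHx IHy|k x IH].
- by rewrite gd semi_lift_d.
- by rewrite gl semi_lift_l IH.
- by rewrite gr semi_lift_r IH.
- by rewrite !linear0.
- by rewrite !linearD IHx IHy.
- by rewrite !linearZ IH.
Qed.

End KaehlerMap.

Theorem Omega1_universal (K : fieldType) (L : preLieType K) (E : preLieMod L)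
    (D : {linear L -> E}) : is_derivation D ->
  exists g : {linear Omega1 L -> E},
    (is_mod_morphism g /\ forall a, g (kd L a) = D a) /\
    (forall g' : {linear Omega1 L -> E},
       is_mod_morphism g' -> (forall a, g' (kd L a) = D a) -> g' =1 g).
Proof.
move=> Dd; exists (semi_lift (f := idHom L) Dd).
split; first (split; first split).
- exact: semi_lift_l.
- exact: semi_lift_r.
- exact: semi_lift_d.
- by move=> g' [gl gr] gd; exact: semi_lift_unique.
Qed.

Section Omega1Map.
Variables (K : fieldType) (L L' : preLieType K) (f : preLieHom L L').

Definition kd_pull : {linear L -> Omega1 L'} := kd L' \o f.

Lemma kd_pull_der a b :
  kd_pull (a ◁ b) = ract (kd_pull a) (f b) + lact (f a) (kd_pull b).
Proof. by rewrite /= hom_mul; exact: kd_derivation. Qed.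

Definition Omega1_map : {linear Omega1 L -> Omega1 L'} := semi_lift kd_pull_der.

Lemma Omega1_map_d a : Omega1_map (kd L a) = kd L' (f a).
Proof. exact: semi_lift_d. Qed.
Lemma Omega1_map_l a e : Omega1_map (lact a e) = lact (f a) (Omega1_map e).
Proof. exact: semi_lift_l. Qed.
Lemma Omega1_map_r e a : Omega1_map (ract e a) = ract (Omega1_map e) (f a).
Proof. exact: semi_lift_r. Qed.

End Omega1Map.

Lemma Omega1_map_id (K : fieldType) (L : preLieType K) :
  Omega1_map (idHom L) =1 id.
Proof.
move=> x; apply/esym.
exact: (@semi_lift_unique _ _ _ _ _ _ (kd_pull_der (idHom L)) idfun).
Qed.

Lemma Omega1_map_comp (K : fieldType) (L1 L2 L3 : preLieType K)
    (g : preLieHom L2 L3) (f : preLieHom L1 L2) :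
  Omega1_map (compHom g f) =1 Omega1_map g \o Omega1_map f.
Proof.
move=> x; apply/esym.
apply: (@semi_lift_unique _ _ _ _ _ _ (kd_pull_der (compHom g f))
          (Omega1_map g \o Omega1_map f)) => *.
- exact: etrans (congr1 (Omega1_map g) (Omega1_map_d f _)) (Omega1_map_d g _).
- exact: etrans (congr1 (Omega1_map g) (Omega1_map_l f _ _)) (Omega1_map_l g _ _).
- exact: etrans (congr1 (Omega1_map g) (Omega1_map_r f _ _)) (Omega1_map_r g _ _).
Qed.

(* Main.v *)
(* The Leibniz rule reads [da ◁ b = d(a ◁ b) - a ◁ db], and the module axiom    *)
(* reads [(a ◁ e) ◁ b = a ◁ (e ◁ b) + (a ◁ b) ◁ e - a ◁ (b ◁ e)].  They push all *)
(* right actions down to the generators, so [Omega1 L] is spanned by the        *)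
(* elements [a1 ◁ (... ◁ (an ◁ db))], i.e. by tensor words.  Conversely, taking *)
(* these two rules as a recursive definition of a right action on [Tbar L],     *)
(* with left action [a ◁ w = a ⊗ w], makes [Tbar L] an L-module in which the    *)
(* inclusion of L is a derivation: [b] acts on a word by the derivation         *)
(* extending [- ◁ b], minus the sum of all insertions of [b] after some letter; *)
(* insertions of two letters commute, and the derivations form a right action   *)
(* of the Lie algebra of L.                                                     *)

Require Import Defs.
From HB Require Import structures.
From mathcomp Require Import all_boot all_order all_algebra.
From mathcomp Require Import boolp.

Set Implicit Arguments.
Unset Strict Implicit.
Unset Printing Implicit Defensive.

Import GRing.Theory.
Local Open Scope ring_scope.

(** Words arise from letters by prepending, so [Tbar V] is initial among vector spaces with a linear
    map from [V] and a bilinear left multiplication by [V] ([Tbar_fold], [Tbar_ext]). Initiality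
    gives [tensor_to_omega], sending a1 ⊗ ... ⊗ an ⊗ b to a1 ◁ (... ◁ (an ◁ db)).

    In the other direction, the Leibniz rule and the mixed module axiom dictate the right action
    [tensor_r] on words. The substantial point is that it also satisfies the axiom with the module
    element first, [tensor_rsym1]. Then [tensor_module] is an L-module, [letter] is a derivation,
    and the universal property yields [omega_to_tensor].

    The two maps match generators and left actions by construction, and right actions by
    [tensor_to_omega_r]; hence both composites are identities. Naturality holds because [tensor_r]
    is built from ◁ and ⊗ alone ([tensor_r_natural]). *)

(** * Right folds over a single tensor power *)

Section TensorPowerFold.
Variables (K : fieldType) (V W : lmodType K).
Variables (D : {linear V -> W}) (l : V -> W -> W).
Hypotheses (l_linearl : forall w, linear (l^~ w)).
Hypotheses (l_linearr : forall v, linear (l v)).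

Lemma tpow_fold_step_linear (U : lmodType K) (g : {linear U -> W}) :
  linear (tensor_lift (fun v u => l v (g u))).
Proof.
apply: tensor_lift_linear => [u|v] k x y; first exact: l_linearl.
by rewrite linearP l_linearr.
Qed.

Fixpoint tpow_fold n : {linear tpow V n -> W} :=
  if n is m.+1 then packLinear (tpow_fold_step_linear (tpow_fold m)) else D.

Lemma tpow_fold_tmul n v (w : tpow V n) :
  tpow_fold n.+1 (tmul v w) = l v (tpow_fold n w).
Proof.
apply: tensor_liftE => [u|u] k x y; first exact: l_linearl.
by rewrite linearP l_linearr.
Qed.

End TensorPowerFold.

(** * Letters, words and induction in the reduced tensor algebra *)

Section TensorAlgebra.
Variables (K : fieldType) (V : lmodType K).

Definition letter_fun (v : V) (n : nat) : tpow V n :=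
  if n is 0 then v else 0.

Lemma letter_subproof v : `[< finite_support (letter_fun v) >].
Proof. by apply/asboolP; exists 1%N; case. Qed.

Definition letter_dsum (v : V) : Tbar V := DSum (letter_subproof v).

Lemma letter_linear : linear letter_dsum.
Proof. by move=> k u v; apply: dsumP => -[|n] //=; rewrite scaler0 addr0. Qed.

Definition letter : {linear V -> Tbar V} := packLinear letter_linear.

Definition prepend_fun (v : V) (x : Tbar V) (n : nat) : tpow V n :=
  if n is m.+1 then tmul v (x m) else 0.

Lemma prepend_subproof v x : `[< finite_support (prepend_fun v x) >].
Proof.
case/asboolP: (dsum_finite x) => N xN.
apply/asboolP; exists N.+1; case=> //= n /xN ->.
exact: lin0 (@tmul_linearr _ _ _ v).
Qed.

Definition prepend (v : V) (x : Tbar V) : Tbar V := DSum (prepend_subproof v x).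

Lemma prepend_linearl x : linear (prepend^~ x).
Proof.
move=> k u v; apply: dsumP => -[|n] /=; first by rewrite scaler0 addr0.
exact: tmul_linearl.
Qed.

Lemma prepend_linearr v : linear (prepend v).
Proof.
move=> k x y; apply: dsumP => -[|n] /=; first by rewrite scaler0 addr0.
exact: tmul_linearr.
Qed.

Definition word n : {linear tpow V n -> Tbar V} :=
  tpow_fold letter prepend_linearl prepend_linearr n.

Lemma word_tmul n v (w : tpow V n) :
  word n.+1 (tmul v w) = prepend v (word n w).
Proof. exact: tpow_fold_tmul. Qed.

Lemma dsum_at_linear m : linear (fun x : Tbar V => x m).
Proof. by []. Qed.

Definition dsum_at m : {linear Tbar V -> tpow V m} :=
  packLinear (dsum_at_linear m).

Lemma word_at n : dsum_at n \o word n =1 id.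
Proof.
elim: n => [//|n IH].
apply: (@tensor_ext _ _ _ _ (dsum_at n.+1 \o word n.+1) idfun) => v w.
by rewrite [LHS](congr1 (dsum_at n.+1) (word_tmul _ _)) /= [X in tmul v X]IH.
Qed.

Lemma word_at_neq n m : n != m -> dsum_at m \o word n =1 (fun=> 0).
Proof.
elim: n m => [[|m]//|n IH] m nm.
apply: (@tensor_ext _ _ _ _ (dsum_at m \o word n.+1) \0) => v w.
rewrite [LHS](congr1 (dsum_at m) (word_tmul _ _)).
case: m nm => [//|m] /= nm; rewrite [X in tmul v X](IH m nm).
exact: lin0 (@tmul_linearr _ _ _ v).
Qed.

Lemma Tbar_sum_words (x : Tbar V) N : (forall n, (N <= n)%N -> x n = 0) ->
  x = \sum_(n < N) word n (x n).
Proof.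
move=> xN; apply: dsumP => m; rewrite -[RHS]/(dsum_at m _) linear_sum /=.
have [mN|Nm] := ltnP m N.
  rewrite (bigD1 (Ordinal mN)) //= [X in X + _]word_at big1 ?addr0 // => i im.
  exact: (@word_at_neq i m im).
rewrite xN // big1 // => i _; apply: (@word_at_neq i m).
by rewrite neq_ltn (leq_trans (ltn_ord i) Nm).
Qed.

Lemma Tbar_ind (P : Tbar V -> Prop) :
  (forall v, P (letter v)) -> (forall v x, P x -> P (prepend v x)) -> P 0 ->
  (forall x y, P x -> P y -> P (x + y)) -> (forall k x, P x -> P (k *: x)) ->
  forall x, P x.
Proof.
move=> Pl Pp P0 PD PZ x; case/asboolP: (dsum_finite x) => N xN.
rewrite (Tbar_sum_words xN); apply: big_ind => // n _.
(* The component is generalized to an arbitrary tensor, since the induction passes to tails of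
   words. *)
elim: {+}(n : nat) (x n) => [|{}n IH] w; first exact: Pl.
elim/(@presented_ind _ _ _ (@tensor_rel K V (tpow V n))): w
  => [[v w]|[]||s t IHs IHt|s IHs|k s IHs].
- by rewrite [word _ _]word_tmul; exact: Pp.
- by rewrite linear0.
- by rewrite linearD; exact: PD.
- by rewrite linearN -scaleN1r; exact: PZ.
- by rewrite linearZ; exact: PZ.
Qed.

Lemma Tbar_ext (W : lmodType K) (g g' : {linear Tbar V -> W})
    (l : V -> W -> W) :
  (forall v, g (letter v) = g' (letter v)) ->
  (forall v x, g (prepend v x) = l v (g x)) ->
  (forall v x, g' (prepend v x) = l v (g' x)) -> g =1 g'.
Proof.
move=> gD gp gp' x.
elim/Tbar_ind: x => [v|v x IH||x y IHx IHy|k x IH].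
- exact: gD.
- by rewrite gp gp' IH.
- by rewrite !linear0.
- by rewrite !linearD IHx IHy.
- by rewrite !linearZ IH.
Qed.

(** * The recursion principle of the reduced tensor algebra *)

Section Fold.
Variables (W : lmodType K) (D : {linear V -> W}) (l : V -> W -> W).
Hypotheses (l_linearl : forall w, linear (l^~ w)).
Hypotheses (l_linearr : forall v, linear (l v)).

Let fold n := tpow_fold D l_linearl l_linearr n.
Let support_bound (x : Tbar V) : nat :=
  sval (cid (asboolW (dsum_finite x))).

Definition Tbar_fold_fun (x : Tbar V) : W :=
  \sum_(n < support_bound x) fold n (x n).

(** The bound in [Tbar_fold_fun] is picked by choice; any other bound changes the sum only by zero
    terms. This allows a common bound for two arguments. *)
Lemma Tbar_fold_funE (x : Tbar V) N : (forall n, (N <= n)%N -> x n = 0) ->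
  Tbar_fold_fun x = \sum_(n < N) fold n (x n).
Proof.
have aux M M' : (forall n, (M <= n)%N -> x n = 0) -> (M <= M')%N ->
    \sum_(n < M) fold n (x n) = \sum_(n < M') fold n (x n).
  move=> xM MM'; rewrite (big_ord_widen _ (fun n => fold n (x n)) MM').
  rewrite big_mkcond; apply: eq_bigr => i _.
  by case: ltnP => // /xM ->; rewrite linear0.
rewrite /Tbar_fold_fun /support_bound; case: cid => M xM /= xN.
by have [MN|/ltnW NM] := leqP M N; [exact: aux|rewrite -(aux N M)].
Qed.

Lemma Tbar_fold_linear : linear Tbar_fold_fun.
Proof.
move=> k x y; case/asboolP: (dsum_finite x) => M xM.
case/asboolP: (dsum_finite y) => N yN.
have xMN n : (maxn M N <= n)%N -> x n = 0.
  by rewrite geq_max => /andP[/xM].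
have yMN n : (maxn M N <= n)%N -> y n = 0.
  by rewrite geq_max => /andP[_ /yN].
rewrite (Tbar_fold_funE xMN) (Tbar_fold_funE yMN).
rewrite (@Tbar_fold_funE _ (maxn M N)); last first.
  by move=> n Mn /=; rewrite xMN // yMN // scaler0 addr0.
rewrite scaler_sumr -big_split /=; apply: eq_bigr => i _; exact: linearP.
Qed.

Definition Tbar_fold : {linear Tbar V -> W} := packLinear Tbar_fold_linear.

Lemma Tbar_fold_letter v : Tbar_fold (letter v) = D v.
Proof.
rewrite [LHS](@Tbar_fold_funE _ 1); last by case.
by rewrite big_ord_recl big_ord0 addr0.
Qed.

Lemma Tbar_fold_prepend v x : Tbar_fold (prepend v x) = l v (Tbar_fold x).
Proof.
case/asboolP: (dsum_finite x) => N xN.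
rewrite [Tbar_fold x](Tbar_fold_funE xN).
(* Prepending raises degrees by one: the bound grows to [N.+1] and the index 0 term vanishes. *)
rewrite [LHS](@Tbar_fold_funE _ N.+1); last first.
  by case=> //= n /xN ->; exact: lin0 (@tmul_linearr _ _ _ v).
rewrite big_ord_recl linear0 add0r.
rewrite -[RHS]/(packLinear (l_linearr v) _) linear_sum.
by apply: eq_bigr => i _; exact: tpow_fold_tmul.
Qed.

End Fold.
End TensorAlgebra.

Lemma Tbar_map_letter (K : fieldType) (V V' : lmodType K)
    (f : {linear V -> V'}) v :
  Tbar_map f (letter V v) = letter V' (f v).
Proof. by apply: dsumP => -[//|n]; exact: (linear0 (tpow_map f n.+1)). Qed.

Lemma Tbar_map_prepend (K : fieldType) (V V' : lmodType K)
    (f : {linear V -> V'}) v (x : Tbar V) :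
  Tbar_map f (prepend v x) = prepend (f v) (Tbar_map f x).
Proof.
by apply: dsumP => -[|n] /=; [rewrite linear0|exact: tensor_mapE].
Qed.

(** As E ◁ E = 0, the module part of an associator splits by the position of its one entry in [E].
    The first identity settles position one; the second settles positions two and three, which right
    symmetry exchanges. *)
Lemma semidirect_right_symmetric (K : fieldType) (L : preLieType K)
    (E : lmodType K) (l : L -> E -> E) (r : E -> L -> E) :
  (forall a, linear (l a)) -> (forall a, linear (r^~ a)) ->
  (forall e a b, r (r e a) b - r e (a ◁ b) = r (r e b) a - r e (b ◁ a)) ->
  (forall a e b, r (l a e) b - l a (r e b) = l (a ◁ b) e - l a (l b e)) ->
  right_symmetric (semidirect_mul l r).
Proof.
move=> ll rl rr lr [a1 e1] [a2 e2] [a3 e3]; rewrite /semidirect_mul /=.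
congr pair; first exact: pl_mul_rsym.
rewrite !(linD _ _ (rl _)) !(linD _ _ (ll _)).
have regroup (x y z x' y' z' : E) :
    x + (y + z) - (x' + y' + z') = (x - x') + ((y - y') + (z - z')).
  by rewrite -(addrA x') opprD addrACA; congr (_ + _); rewrite opprD addrACA.
by rewrite !regroup rr !lr addrCA.
Qed.

(** * The L-module structure on the reduced tensor algebra *)

Section TensorModule.
Variables (K : fieldType) (L : preLieType K).
Implicit Types (a b c : L) (x y : Tbar L).

Let prependDl a b x : prepend (a + b) x = prepend a x + prepend b x.
Proof. exact: (linD a b (prepend_linearl x)). Qed.
Let prependDr a x y : prepend a (x + y) = prepend a x + prepend a y.
Proof. exact: (linD x y (prepend_linearr a)). Qed.
Let prependZl k a x : prepend (k *: a) x = k *: prepend a x.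
Proof. exact: (linearZ_LR (packLinear (prepend_linearl x))). Qed.
Let prependZr k a x : prepend a (k *: x) = k *: prepend a x.
Proof. exact: (linearZ_LR (packLinear (prepend_linearr a))). Qed.
Let prependNl a x : prepend (- a) x = - prepend a x.
Proof. exact: (linearN (packLinear (prepend_linearl x))). Qed.
Let prependNr a x : prepend a (- x) = - prepend a x.
Proof. exact: (linearN (packLinear (prepend_linearr a))). Qed.
Let prependE := (prependDl, prependDr, prependZl, prependZr, prependNl, prependNr).

Lemma right_letter_linear b :
  linear (fun a : L => (letter L a, letter L (a ◁ b) - prepend a (letter L b))).
Proof.
move=> k a c; rewrite pl_mul_linearl !linearP !prependE.
by congr pair; rewrite /= scalerBr opprD addrACA.
Qed.

(* Computes [x] together with its image under the right action of [b], because *)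
(* the recursion for the latter also refers to [x] itself.                     *)
Definition right_step b a (p : Tbar L * Tbar L) : Tbar L * Tbar L :=
  (prepend a p.1,
   prepend a p.2 + prepend (a ◁ b) p.1 - prepend a (prepend b p.1)).

Lemma right_step_linearl b p : linear (fun a => right_step b a p).
Proof.
move=> k a c; rewrite /right_step pl_mul_linearl !prependE.
by congr pair; rewrite /= scalerBr scalerDr opprD
  [in LHS](addrACA (k *: _)) [LHS]addrACA.
Qed.

Lemma right_step_linearr b a : linear (right_step b a).
Proof.
move=> k p q; rewrite /right_step /= !prependE.
by congr pair; rewrite /= scalerBr scalerDr opprD [in LHS](addrACA (k *: _)) [LHS]addrACA.
Qed.

Definition right_fold b : {linear Tbar L -> (Tbar L * Tbar L)%type} :=
  Tbar_fold (packLinear (right_letter_linear b))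
    (right_step_linearl b) (right_step_linearr b).

Lemma right_fold1 b x : (right_fold b x).1 = x.
Proof.
apply: (@Tbar_ext _ _ _ (fst \o right_fold b) idfun (@prepend _ _)) => //.
- by move=> v; rewrite [LHS](congr1 fst (Tbar_fold_letter _ _ _ _)).
- by move=> v y; rewrite [LHS](congr1 fst (Tbar_fold_prepend _ _ _ _ _)).
Qed.

Definition tensor_r x b : Tbar L := (right_fold b x).2.

Lemma tensor_r_letter a b :
  tensor_r (letter L a) b = letter L (a ◁ b) - prepend a (letter L b).
Proof. by rewrite /tensor_r Tbar_fold_letter. Qed.

Lemma tensor_r_prepend a x b : tensor_r (prepend a x) b =
  prepend a (tensor_r x b) + prepend (a ◁ b) x - prepend a (prepend b x).
Proof. by rewrite /tensor_r [in LHS]Tbar_fold_prepend /= right_fold1. Qed.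

Lemma tensor_r_linearl b : linear (tensor_r^~ b).
Proof. by move=> k x y; rewrite /tensor_r linearP. Qed.

Let tensor_rDl b x y : tensor_r (x + y) b = tensor_r x b + tensor_r y b.
Proof. exact: (linearD (packLinear (tensor_r_linearl b))). Qed.
Let tensor_rNl b x : tensor_r (- x) b = - tensor_r x b.
Proof. exact: (linearN (packLinear (tensor_r_linearl b))). Qed.
Let tensor_rZl b k x : tensor_r (k *: x) b = k *: tensor_r x b.
Proof. exact: (linearZ_LR (packLinear (tensor_r_linearl b))). Qed.
Let tensor_r0l b : tensor_r 0 b = 0.
Proof. exact: (linear0 (packLinear (tensor_r_linearl b))). Qed.

Lemma tensor_r_linearr x : linear (tensor_r x).
Proof.
move=> k a b; elim/Tbar_ind: x => [c|c x IH||x y IHx IHy|h x IH].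
- rewrite !tensor_r_letter pl_mul_linearr !linearP !prependE.
  by rewrite scalerBr opprD addrACA.
- rewrite !tensor_r_prepend pl_mul_linearr IH !prependE.
  by rewrite scalerBr scalerDr opprD [in LHS](addrACA (k *: _)) [LHS]addrACA.
- by rewrite !tensor_r0l scaler0 addr0.
- by rewrite !tensor_rDl IHx IHy scalerDr addrACA.
- by rewrite !tensor_rZl IH scalerDr !scalerA mulrC.
Qed.

Lemma tensor_rsym2 a x b :
  tensor_r (prepend a x) b - prepend a (tensor_r x b) =
  prepend (a ◁ b) x - prepend a (prepend b x).
Proof.
by rewrite tensor_r_prepend -[in LHS](addrA (prepend _ _)) [LHS]addrC addKr.
Qed.

(** Acting by [a], then [b], and subtracting the action of [a ◁ b] leaves an expression symmetric in
    [a] and [b]: an associator in the first letter, the same expression on the tail, and sums over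
    both orders of [a] and [b]. *)
Lemma tensor_rsym1 x a b :
  tensor_r (tensor_r x a) b - tensor_r x (a ◁ b) =
  tensor_r (tensor_r x b) a - tensor_r x (b ◁ a).
Proof.
elim/Tbar_ind: x => [c|c x IH||x y IHx IHy|k x IH].
- have E a' b' : tensor_r (tensor_r (letter L c) a') b' -
        tensor_r (letter L c) (a' ◁ b') =
      letter L (c ◁ a' ◁ b' - c ◁ (a' ◁ b')) -
      (prepend (c ◁ a') (letter L b') + prepend (c ◁ b') (letter L a')) +
      (prepend c (prepend a' (letter L b')) +
       prepend c (prepend b' (letter L a'))).
    rewrite !tensor_r_letter tensor_rDl tensor_rNl tensor_r_letter.
    rewrite tensor_r_prepend tensor_r_letter !prependE (linearB (letter L)).
    (* Summands 3 and 8 are the two copies of c ⊗ (a' ◁ b'), with opposite signs. *)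
    rewrite !opprD !opprK !addrA [LHS](ACl (1*7*2*5*4*6*(3*8))).
    by rewrite /= addNr addr0.
  by rewrite !E pl_mul_rsym (addrC (prepend (c ◁ b) _))
    (addrC (prepend c (prepend b _))).
- have E a' b' : tensor_r (tensor_r (prepend c x) a') b' -
        tensor_r (prepend c x) (a' ◁ b') =
      prepend c (tensor_r (tensor_r x a') b' - tensor_r x (a' ◁ b')) +
      prepend (c ◁ a' ◁ b' - c ◁ (a' ◁ b')) x +
      (prepend (c ◁ b') (tensor_r x a') + prepend (c ◁ a') (tensor_r x b')) -
      (prepend c (prepend b' (tensor_r x a')) +
       prepend c (prepend a' (tensor_r x b'))) -
      (prepend (c ◁ a') (prepend b' x) + prepend (c ◁ b') (prepend a' x)) +
      (prepend c (prepend a' (prepend b' x)) +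
       prepend c (prepend b' (prepend a' x))).
    rewrite !tensor_r_prepend !(tensor_rDl, tensor_rNl) !tensor_r_prepend.
    rewrite !prependE !opprD !opprK !addrA.
    (* Summands 8 and 14 are c ⊗ (a' ◁ b') ⊗ x with opposite signs. *)
    rewrite [LHS](ACl (1*12*5*13*2*4*3*7*6*10*9*11*(8*14))).
    by rewrite /= addNr addr0.
  rewrite !E IH pl_mul_rsym; congr (_ + _ - _ - _ + _); exact: addrC.
- by rewrite !tensor_r0l.
- by rewrite !tensor_rDl !opprD addrACA IHx IHy addrACA.
- by rewrite !tensor_rZl -!scalerBr IH.
Qed.

Definition tensor_module : preLieMod L :=
  PreLieMod (@prepend_linearl _ L) (@prepend_linearr _ L)
    tensor_r_linearl tensor_r_linearr
    (semidirect_right_symmetric (@prepend_linearr _ L) tensor_r_linearl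
       tensor_rsym1 tensor_rsym2).

Lemma letter_derivation : is_derivation (letter L : {linear L -> tensor_module}).
Proof. by move=> a b; rewrite [ract _ _]tensor_r_letter subrK. Qed.

(** * The two mutually inverse maps *)

Definition omega_to_tensor : {linear Omega1 L -> Tbar L} :=
  semi_lift (f := idHom L) letter_derivation.

Lemma omega_to_tensor_d a : omega_to_tensor (kd L a) = letter L a.
Proof. exact: (@semi_lift_d _ _ _ (idHom L) _ _ letter_derivation). Qed.
Lemma omega_to_tensor_l a e :
  omega_to_tensor (lact a e) = prepend a (omega_to_tensor e).
Proof. exact: (@semi_lift_l _ _ _ (idHom L) _ _ letter_derivation). Qed.
Lemma omega_to_tensor_r e a :
  omega_to_tensor (ract e a) = tensor_r (omega_to_tensor e) a.
Proof. exact: (@semi_lift_r _ _ _ (idHom L) _ _ letter_derivation). Qed.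

Definition tensor_to_omega : {linear Tbar L -> Omega1 L} :=
  Tbar_fold (kd L) (@lact_linearl _ _ (Omega1 L)) (@lact_linearr _ _ (Omega1 L)).

(** The rules defining [tensor_r] hold in [Omega1 L]: on letters this is the Leibniz rule, on longer
    words the axiom [lact_rsym]. *)
Lemma tensor_to_omega_r x b :
  tensor_to_omega (tensor_r x b) = ract (tensor_to_omega x) b.
Proof.
elim/Tbar_ind: x => [a|a x IH||x y IHx IHy|k x IH].
- rewrite tensor_r_letter linearB Tbar_fold_prepend !Tbar_fold_letter.
  by rewrite kd_derivation addrK.
- rewrite tensor_r_prepend -addrA linearD linearB !Tbar_fold_prepend IH.
  by rewrite -lact_rsym addrC subrK.
- by rewrite tensor_r0l linear0 ract0l.
- by rewrite tensor_rDl !linearD IHx IHy (linD _ _ (ract_linearl b)).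
- rewrite tensor_rZl !linearZ IH.
  exact/esym/(linearZ_LR (packLinear (@ract_linearl _ _ (Omega1 L) b))).
Qed.

Lemma omega_to_tensorK : cancel omega_to_tensor tensor_to_omega.
Proof.
move=> w; elim/Omega1_ind: w => [a|a e IH|e a IH||x y IHx IHy|k x IH].
- by rewrite omega_to_tensor_d [LHS]Tbar_fold_letter.
- by rewrite omega_to_tensor_l [LHS]Tbar_fold_prepend IH.
- by rewrite omega_to_tensor_r tensor_to_omega_r IH.
- by rewrite !linear0.
- by rewrite !linearD IHx IHy.
- by rewrite !linearZ IH.
Qed.

Lemma tensor_to_omegaK : cancel tensor_to_omega omega_to_tensor.
Proof.
apply: (@Tbar_ext _ _ _ (omega_to_tensor \o tensor_to_omega) idfun
  (@prepend _ _)) => //.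
- move=> v; rewrite [LHS](congr1 omega_to_tensor (Tbar_fold_letter _ _ _ _)).
  exact: omega_to_tensor_d.
- move=> v y.
  rewrite [LHS](congr1 omega_to_tensor (Tbar_fold_prepend _ _ _ _ _)).
  exact: omega_to_tensor_l.
Qed.

End TensorModule.

(** * Naturality in the pre-Lie algebra *)

Lemma tensor_r_natural (K : fieldType) (L L' : preLieType K)
    (f : preLieHom L L') (x : Tbar L) b :
  Tbar_map f (tensor_r x b) = tensor_r (Tbar_map f x) (f b).
Proof.
elim/Tbar_ind: x => [a|a x IH||x y IHx IHy|k x IH].
- rewrite Tbar_map_letter !tensor_r_letter linearB Tbar_map_prepend.
  by rewrite !Tbar_map_letter hom_mul.
- rewrite Tbar_map_prepend !tensor_r_prepend linearB linearD.
  by rewrite !Tbar_map_prepend hom_mul IH.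
- by rewrite linear0 /tensor_r !linear0.
- rewrite linearD (linD _ _ (tensor_r_linearl b)) linearD IHx IHy.
  by rewrite (linD _ _ (tensor_r_linearl (f b))).
- rewrite linearZ [tensor_r _ b](linearZ_LR (packLinear (tensor_r_linearl b))).
  rewrite linearZ IH; apply/esym.
  exact: (linearZ_LR (packLinear (tensor_r_linearl (f b)))).
Qed.

Lemma omega_to_tensor_natural (K : fieldType) (L L' : preLieType K)
    (f : preLieHom L L') (w : Omega1 L) :
  omega_to_tensor L' (Omega1_map f w) = Tbar_map f (omega_to_tensor L w).
Proof.
elim/Omega1_ind: w => [a|a e IH|e a IH||x y IHx IHy|k x IH].
- rewrite Omega1_map_d !omega_to_tensor_d.
  by rewrite Tbar_map_letter.
- rewrite Omega1_map_l !omega_to_tensor_l.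
  by rewrite Tbar_map_prepend -IH.
- rewrite Omega1_map_r !omega_to_tensor_r.
  by rewrite tensor_r_natural -IH.
- by rewrite !linear0.
- by rewrite !linearD IHx IHy.
- by rewrite !linearZ IH.
Qed.

Theorem theorem3 (K : fieldType) (charK0 : [pchar K] =i pred0) :
  exists phi : forall L : preLieType K, {linear Omega1 L -> Tbar L},
    (forall L : preLieType K, bijective (phi L)) /\
    (forall (L L' : preLieType K) (f : preLieHom L L') (w : Omega1 L),
       phi L' (Omega1_map f w) = Tbar_map f (phi L w)).
Proof.
exists (@omega_to_tensor K); split; last exact: omega_to_tensor_natural.
by move=> L; exists (@tensor_to_omega K L);
  [exact: omega_to_tensorK|exact: tensor_to_omegaK].
Qed.
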